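(* Let $\alpha,\beta>0$ and consider the asymmetric annihilation process on $L$ sites. For $2\le m<L$, the stationary evaporation rate at the bond $(m-1,m)$ is $$\langle\eta_{m-1}\eta_m\rangle=\frac{\alpha^2}{2^{2m-3}(1+2\alpha)^m}\sum_{i=0}^{m-2}\frac{m-1-i}{m-1}\binom{m-2+i}{i}(1+2\alpha)^i\,2^{m-2-i},$$ and, as $m\to\infty$ (with $L>m$; the value does not depend on $L$), $$\langle\eta_{m-1}\eta_m\rangle\sim\frac{1}{8\sqrt{\pi m^3}}.$$
   Context: The model: a continuous-time Markov chain on configurations $\eta=(\eta_1,\dots,\eta_L)\in\{0,1\}^L$ ($\eta_i=1$ if site $i$ is occupied, $0$ if empty), with parameters $\alpha,\beta>0$ and the following transitions. Bulk: for each pair of neighbouring sites $(i,i+1)$, $1\le i\le L-1$, $10\to 01$ with rate $1$ and $11\to 00$ with rate $1$. Left boundary: at site $1$, $0\to 1$ with rate $\alpha$ and $1\to 0$ with rate $\alpha$. Right boundary: at site $L$, $1\to0$ with rate $\beta$. The bracket $\langle\cdot\rangle$ denotes expectation with respect to the unique stationary distribution of this chain. The evaporation rate at the bond $(m-1,m)$ is by definition $\langle\eta_{m-1}\eta_m\rangle$. The symbol $\sim$ means that the ratio of the two sides tends to $1$. *)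

(* Defs.v *)
From HB Require Import structures.
From mathcomp Require Import all_boot all_order all_algebra.
From mathcomp Require Import all_classical all_reals all_analysis.
From mathcomp Require Import zify lra.
Set Implicit Arguments.
Unset Strict Implicit.
Unset Printing Implicit Defensive.
Import Order.TTheory GRing.Theory Num.Theory.
Import numFieldNormedType.Exports.
Local Open Scope ring_scope.

(* Continuous-time Markov chains on a finite state space S, given by their
   jump rates q x y from x to y. Diagonal values q x x are irrelevant: they
   cancel in the balance equations. *)
Section FiniteChain.
Context {R : realType} {S : finType}.
Implicit Types (q : S -> S -> R) (p v : S -> R).

Definition balanced q v : Prop :=
  forall y, \sum_x v x * q x y = v y * \sum_z q y z.

Definition is_stationary q p : Prop :=
  [/\ forall x, 0 <= p x, \sum_x p x = 1 & balanced q p].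

(* The stationary distribution, meaningful when it exists and is unique
   (see [is_stationary_ex] and [is_stationary_inj]); 0 if there is none. *)
Definition stationary q : {ffun S -> R} :=
  xget 0 [set p : {ffun S -> R} | is_stationary q p]%classic.

Definition expectation q (f : S -> R) : R := \sum_x stationary q x * f x.

Lemma balanced_abs q v : (forall x y, 0 <= q x y) -> balanced q v ->
  balanced q (fun x => `|v x|).
Proof.
move=> q0 bv.
have le_y y : 0 <= \sum_x `|v x| * q x y - `|v y| * \sum_z q y z.
  rewrite subr_ge0 -[X in _ * X]ger0_norm ?sumr_ge0// -normrM -bv.
  apply: le_trans (ler_norm_sum _ _ _) _.
  by apply: ler_sum => x _; rewrite normrM (ger0_norm (q0 _ _)).
have sum0 : \sum_y (\sum_x `|v x| * q x y - `|v y| * \sum_z q y z) = 0.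
  rewrite sumrB exchange_big /= -sumrB big1// => x _.
  by rewrite -mulr_sumr subrr.
move=> y; apply/eqP; rewrite -subr_eq0; apply/eqP.
by apply: (psumr_eq0P _ sum0) => // z _; exact: le_y.
Qed.

Lemma balanced_connect q p x e : (forall x y, 0 <= q x y) ->
  (forall x, 0 <= p x) -> balanced q p ->
  connect [rel a b | 0 < q a b] x e -> 0 < p x -> 0 < p e.
Proof.
move=> q0 p0 bp /connectP[s + ->].
elim: s x => //= y s IH x /andP[qxy sP] px; apply: IH sP _.
rewrite lt_neqAle p0 andbT eq_sym; apply/eqP => py0.
have := bp y; rewrite py0 mul0r => sum0.
have /eqP : p x * q x y = 0.
  by apply: (psumr_eq0P _ sum0) => // z _; rewrite mulr_ge0.
by rewrite gt_eqF// mulr_gt0.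
Qed.

Lemma is_stationary_inj q p p' e : (forall x y, 0 <= q x y) ->
  (forall x, connect [rel a b | 0 < q a b] x e) ->
  is_stationary q p -> is_stationary q p' -> p =1 p'.
Proof.
move=> q0 qe [p0 p1 bp] [p'0 p'1 bp'].
pose w x := p x - p' x.
have bw : balanced q w.
  move=> y; rewrite /w mulrBl -bp -bp' -sumrB.
  by apply: eq_bigr => x _; rewrite mulrBl.
have bw' := balanced_abs q0 bw.
have bD (c : R) : balanced q (fun x => `|w x| + c * w x).
  move=> y; rewrite mulrDl -mulrA -bw' -bw mulr_sumr -big_split /=.
  by apply: eq_bigr => x _; rewrite mulrDl mulrA.
have w_sum : \sum_x w x = 0 by rewrite sumrB p1 p'1 subrr.
have pos (c : R) x : `|c| = 1 -> 0 < c * w x -> 0 < c * w e.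
  move=> c1 cw.
  have nn z : 0 <= `|w z| + c * w z.
    by have := ler_norm (- (c * w z)); rewrite normrN normrM c1 mul1r; lra.
  have := balanced_connect q0 nn (bD c) (qe x).
  have ->: 0 < `|w x| + c * w x by have := normr_ge0 (w x); lra.
  move=> /(_ isT).
  have [//|le0] := ltP 0 (c * w e).
  have : `|c * w e| = - (c * w e) by rewrite ler0_norm.
  by rewrite normrM c1 mul1r => ->; rewrite addNr ltxx.
have neg (c : R) : `|c| = 1 -> c * w e <= 0 -> forall x, c * w x <= 0.
  by move=> c1 le0 x; rewrite leNgt; apply/negP => /(pos _ _ c1); rewrite ltNge le0.
have zero (c : R) : `|c| = 1 -> c * w e <= 0 -> forall x, w x = 0.
  move=> c1 le0 x.
  have h : \sum_x - (c * w x) = 0 by rewrite sumrN -mulr_sumr w_sum mulr0 oppr0.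
  have : - (c * w x) = 0.
    by apply: (psumr_eq0P _ h) => // z _; rewrite oppr_ge0 neg.
  move=> /eqP; rewrite oppr_eq0 mulf_eq0 -normr_eq0 c1 oner_eq0 /= => /eqP-> //.
move=> x; apply/eqP; rewrite -subr_eq0; apply/eqP.
have [le0|/ltW ge0] := leP (w e) 0.
  by apply: (zero 1); rewrite ?normr1 ?mul1r.
by apply: (zero (-1)); rewrite ?normrN1 ?mulN1r ?oppr_le0.
Qed.

Lemma is_stationary_ex q : (forall x y, 0 <= q x y) -> (0 < #|S|)%N ->
  exists p : {ffun S -> R}, is_stationary q p.
Proof.
move=> q0 S0.
pose A : 'M[R]_#|S| := \matrix_(i, j)
  (q (enum_val i) (enum_val j) - (i == j)%:R * \sum_z q (enum_val i) z).
have sum_enum (F : S -> R) : \sum_x F x = \sum_(i < #|S|) F (enum_val i).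
  by rewrite (reindex_onto enum_val enum_rank) /= => [|x _]; rewrite ?enum_rankK//;
    apply: eq_bigl => i; rewrite enum_valK eqxx.
have /det0P[v v0 vA] : \det A == 0.
  rewrite -det_tr; apply/det0P; exists (const_mx 1).
    apply/eqP => /rowP/(_ (Ordinal S0)); rewrite !mxE => /eqP.
    by rewrite oner_eq0.
  apply/rowP => i; rewrite !mxE.
  under eq_bigr do rewrite !mxE mul1r.
  rewrite sumrB -(sum_enum (q (enum_val i))) -mulr_suml.
  suff -> : \sum_(j < #|S|) (i == j)%:R = 1 :> R by rewrite mul1r subrr.
  by rewrite (bigD1 i)//= eqxx big1 ?addr0// => j; rewrite eq_sym => /negbTE->.
pose u x := v 0 (enum_rank x).
have bu : balanced q u.
  move=> y; move/rowP/(_ (enum_rank y)): vA; rewrite !mxE.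
  under eq_bigr do rewrite !mxE enum_rankK mulrBr.
  rewrite sumrB => /eqP; rewrite subr_eq0 => /eqP h.
  rewrite (sum_enum (fun x => u x * q x y)) /u.
  rewrite (eq_bigr (fun i => v 0 i * q (enum_val i) y)); last first.
    by move=> i _; rewrite enum_valK.
  rewrite h (bigD1 (enum_rank y))//= eqxx mul1r enum_rankK.
  rewrite [X in _ + X]big1 ?addr0// => j /negbTE->.
  by rewrite mul0r mulr0.
have bu' := balanced_abs q0 bu.
pose s := \sum_x `|u x|.
have s0 : s != 0.
  apply: contra_neq v0 => s0; apply/rowP => i; rewrite mxE.
  have : `|u (enum_val i)| = 0 by apply: (psumr_eq0P _ s0).
  by rewrite /u enum_valK => /normr0_eq0.
exists [ffun x => `|u x| / s]; split.
- by move=> x; rewrite ffunE divr_ge0// sumr_ge0.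
- under eq_bigr do rewrite ffunE.
  by rewrite -mulr_suml divff.
- move=> y; rewrite ffunE mulrAC -bu' mulr_suml.
  by apply: eq_bigr => x _; rewrite ffunE mulrAC.
Qed.

End FiniteChain.

Section AsymmetricAnnihilation.
Context {R : realType} (L : nat).

(* The site numbered k (1 <= k <= L) is the element of 'I_L of value k - 1;
   [occ eta k] is eta_k, and the rates are those of the jump eta -> zeta. *)
Definition config := {ffun 'I_L -> bool}.

Implicit Types (eta zeta : config) (alpha beta : R).

Definition occ eta (k : nat) : bool := [exists i : 'I_L, (i.+1 == k) && eta i].

Definition set_site eta (i : 'I_L) (b : bool) : config :=
  [ffun k => if k == i then b else eta k].

Definition bulk_rate eta zeta : R :=
  \sum_(i < L) \sum_(j < L | j == i.+1 :> nat)
    ([&& eta i, ~~ eta j & zeta == set_site (set_site eta i false) j true]%:R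
   + [&& eta i, eta j & zeta == set_site (set_site eta i false) j false]%:R).

Definition left_rate alpha eta zeta : R :=
  \sum_(i < L | i == 0 :> nat)
    (alpha * (~~ eta i && (zeta == set_site eta i true))%:R
   + alpha * (eta i && (zeta == set_site eta i false))%:R).

Definition right_rate beta eta zeta : R :=
  \sum_(i < L | i.+1 == L :> nat)
    beta * (eta i && (zeta == set_site eta i false))%:R.

Definition rate alpha beta eta zeta : R :=
  bulk_rate eta zeta + left_rate alpha eta zeta + right_rate beta eta zeta.

Definition evaporation_rate alpha beta (m : nat) : R :=
  expectation (rate alpha beta)
    (fun eta => (occ eta m.-1)%:R * (occ eta m)%:R).

Definition empty_config : config := [ffun=> false].

Lemma bulk_rate_ge0 eta zeta : 0 <= bulk_rate eta zeta.
Proof. by do 2![apply: sumr_ge0 => ? _]; rewrite addr_ge0. Qed.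

Lemma left_rate_ge0 alpha eta zeta : 0 < alpha -> 0 <= left_rate alpha eta zeta.
Proof. by move=> /ltW a0; apply: sumr_ge0 => ? _; rewrite addr_ge0 ?mulr_ge0. Qed.

Lemma right_rate_ge0 beta eta zeta : 0 < beta -> 0 <= right_rate beta eta zeta.
Proof. by move=> /ltW b0; apply: sumr_ge0 => ? _; rewrite mulr_ge0. Qed.

Lemma rate_ge0 alpha beta eta zeta : 0 < alpha -> 0 < beta ->
  0 <= rate alpha beta eta zeta.
Proof.
by move=> a0 b0; rewrite !addr_ge0 ?bulk_rate_ge0 ?left_rate_ge0 ?right_rate_ge0.
Qed.

Lemma connect_empty alpha beta eta : 0 < alpha -> 0 < beta ->
  connect [rel x y | 0 < rate alpha beta x y] eta empty_config.
Proof.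
move=> a0 b0.
pose mu (x : config) := (\sum_(k < L) x k * (L - k))%N.
have [n] := ubnP (mu eta); elim: n eta => // n IH eta; rewrite ltnS => le_n.
have [/existsP[i etai]|/existsPn no] := boolP [exists i, eta i]; last first.
  have -> : eta = empty_config; last exact: connect0.
  by apply/ffunP => i; rewrite ffunE; apply/negbTE.
pose e1 := set_site eta i false.
have mu1 : (mu eta = L - i + mu e1)%N.
  rewrite /mu (bigD1 i)//= etai mul1n [in RHS](bigD1 i)//= ffunE eqxx mul0n add0n.
  by congr addn; apply: eq_bigr => k /negbTE ki; rewrite ffunE ki.
have iL := ltn_ord i.
have [lt|ge] := ltnP i.+1 L.
  pose j := Ordinal lt.
  have ji : j != i by rewrite -val_eqE /= gtn_eqF.
  pose e2 := set_site e1 j (~~ eta j).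
  have mu2 : (mu e2 <= L - i.+1 + mu e1)%N.
    rewrite /mu (bigD1 j)//= [in leqRHS](bigD1 j)//=.
    rewrite (eq_bigr (fun k : 'I_L => e1 k * (L - k))%N); last first.
      by move=> k /negbTE kj; rewrite [e2 _]ffunE kj.
    by rewrite addnA leq_add2r; case: (e2 j); lia.
  apply: (@connect_trans _ _ e2); last by apply: IH; lia.
  apply: connect1 => /=.
  rewrite /rate -addrA ltr_wpDr ?addr_ge0 ?left_rate_ge0 ?right_rate_ge0//.
  rewrite /bulk_rate (bigD1 i)//= ltr_wpDr//.
    by do 2![apply: sumr_ge0 => ? _]; rewrite addr_ge0.
  rewrite (bigD1 j)//= ltr_wpDr//.
    by apply: sumr_ge0 => ? _; rewrite addr_ge0.
  by rewrite /e2 /e1 etai; case: (eta j) => /=; rewrite eqxx ?addr0 ?add0r ltr01.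
apply: (@connect_trans _ _ e1); last by apply: IH; lia.
apply: connect1 => /=.
rewrite /rate ltr_wpDl ?addr_ge0 ?bulk_rate_ge0 ?left_rate_ge0//.
have iL' : i.+1 == L by rewrite eqn_leq iL.
rewrite /right_rate (bigD1 i)//= ltr_wpDr//.
  by apply: sumr_ge0 => ? _; rewrite mulr_ge0// ltW.
by rewrite etai eqxx mulr1.
Qed.

Lemma stationaryP alpha beta : 0 < alpha -> 0 < beta ->
  is_stationary (rate alpha beta) (stationary (rate alpha beta)).
Proof.
move=> a0 b0; rewrite /stationary; case: xgetP => // no.
have [||p pP] := @is_stationary_ex R config (rate alpha beta).
- by move=> *; exact: rate_ge0.
- by apply/card_gt0P; exists empty_config.
- by case: (no p).
Qed.

Lemma stationary_unique alpha beta (p : config -> R) : 0 < alpha -> 0 < beta ->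
  is_stationary (rate alpha beta) p -> p =1 stationary (rate alpha beta).
Proof.
move=> a0 b0 pP; apply: is_stationary_inj pP (stationaryP a0 b0).
- by move=> *; exact: rate_ge0.
- by move=> x; exact: connect_empty.
Qed.

End AsymmetricAnnihilation.

Arguments evaporation_rate {R} L alpha beta m.

(* Main.v *)
Require Import Defs.
From mathcomp Require Import all_boot all_order all_algebra.
From mathcomp Require Import all_classical all_reals all_analysis.
From mathcomp Require Import zify ring lra.
Import Order.TTheory GRing.Theory Num.Theory.
Import numFieldNormedType.Exports.
Local Open Scope classical_set_scope.
Local Open Scope ring_scope.

(* In the spin variables sigma_k = (-1)^(eta_1 + ... + eta_k) the process is a
   voter model: a jump over the bond (k, k+1) makes sigma_k copy sigma_(k-1).
   Hence the stationary correlations g(i, j) = <sigma_i sigma_j> satisfy, for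
   0 < i < j < L, 2 g(i, j) = g(i-1, j) + g(i, j-1), with g(i, i) = 1 and
   g(0, j) = x^j, where x = 1 / (1 + 2 alpha). The evaporation rate at
   (m-1, m) is a quarter of the mixed second difference of 1 - g there; this
   difference is discrete harmonic for the same recursion, vanishes on the
   diagonal and has boundary values proportional to x^j, so the reflection
   principle expresses it by ballot numbers. Compared with the central binomial
   coefficient, the sum tends to that of (k + 1) x^k, which is (1 - x)^-2, and
   Wallis' inequalities give the central binomial coefficient. *)

(** * Generator of the chain acting on products of spins *)

Section Drift.
Context {R : realType}.

(** The generator applied to any observable has stationary mean zero: after exchanging the two sums,
    the balance equation at [y] cancels inflow against outflow. Every relation between correlations
    below comes from this identity. *)
Lemma stationary_drift0 (S : finType) (q : S -> S -> R) (p f : S -> R) :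
  is_stationary q p -> \sum_x p x * \sum_y q x y * (f y - f x) = 0.
Proof.
move=> [_ _ bal].
under eq_bigr => x _.
  under eq_bigr do rewrite mulrBr.
  rewrite sumrB mulrBr -mulr_suml !mulr_sumr.
  over.
rewrite sumrB exchange_big /= -sumrB big1 // => y _.
under eq_bigr do rewrite mulrA.
by rewrite -mulr_suml bal mulrA subrr.
Qed.

Lemma sum_jump (S : finType) (P : bool) (w x : S) (f : S -> R) :
  \sum_z (P && (z == w))%:R * (f z - f x) = P%:R * (f w - f x).
Proof.
rewrite (bigD1 w) //= eqxx andbT big1 ?addr0 // => z /negbTE ->.
by rewrite andbF mul0r.
Qed.

Context (L : nat).
Implicit Types (e : config L) (f : config L -> R).

(** Both bulk moves empty site [a] and flip its right neighbour [b], at rate 1 whenever [a] is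
    occupied; so they merge into a single jump. *)
Lemma bulk_drift f e :
  \sum_z bulk_rate e z * (f z - f e) =
  \sum_(a < L) \sum_(b < L | b == a.+1 :> nat)
    (e a)%:R * (f (set_site (set_site e a false) b (~~ e b)) - f e).
Proof.
rewrite /bulk_rate.
under eq_bigr do rewrite mulr_suml.
rewrite exchange_big /=; apply: eq_bigr => a _.
under eq_bigr do rewrite mulr_suml.
rewrite exchange_big /=; apply: eq_bigr => b _.
under eq_bigr do rewrite mulrDl !andbA.
rewrite big_split /= !sum_jump.
by case: (e a); case: (e b); rewrite /= ?mul1r ?mul0r ?addr0 ?add0r.
Qed.

Lemma left_drift alpha f e :
  \sum_z left_rate alpha e z * (f z - f e) =
  \sum_(a < L | a == 0 :> nat) alpha * (f (set_site e a (~~ e a)) - f e).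
Proof.
rewrite /left_rate.
under eq_bigr do rewrite mulr_suml.
rewrite exchange_big /=; apply: eq_bigr => a _.
under eq_bigr do rewrite mulrDl -!mulrA.
rewrite big_split /= -!mulr_sumr !sum_jump.
by case: (e a); rewrite /= ?mul1r ?mul0r ?mulr0 ?addr0 ?add0r.
Qed.

Lemma right_drift beta f e :
  \sum_z right_rate beta e z * (f z - f e) =
  \sum_(a < L | a.+1 == L :> nat)
    beta * ((e a)%:R * (f (set_site e a false) - f e)).
Proof.
rewrite /right_rate.
under eq_bigr do rewrite mulr_suml.
rewrite exchange_big /=; apply: eq_bigr => a _.
under eq_bigr do rewrite -!mulrA.
by rewrite -!mulr_sumr !sum_jump.
Qed.

(* sigma_i sigma_j for i <= j: the ordinals are the site numbers minus one. *)
Definition spin_product (i j : nat) e : R :=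
  \prod_(k < L | (i <= k < j)%N) (-1) ^+ e k.

Lemma spin_product_set i j e (a : 'I_L) c :
  spin_product i j (set_site e a c) =
  (-1) ^+ ((i <= a < j)%N && (c (+) e a)) * spin_product i j e.
Proof.
rewrite /spin_product; case: (boolP (i <= a < j)%N) => aij /=; last first.
  rewrite mul1r; apply: eq_bigr => k kij; rewrite ffunE.
  by case: eqP kij => // ->; rewrite (negbTE aij).
rewrite (bigD1 a) //= [X in _ = _ * X](bigD1 a) //= mulrA ffunE eqxx.
congr (_ * _); first by rewrite -signr_addb -addbA addbb addbF.
by apply: eq_bigr => k /andP[_ /negbTE ka]; rewrite ffunE ka.
Qed.

Lemma spin_product_nil i e : spin_product i i e = 1.
Proof. by rewrite /spin_product big_pred0 // => k; lia. Qed.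

Lemma spin_productSr i j (b : 'I_L) e : (i <= j)%N -> b = j :> nat ->
  spin_product i j.+1 e = (-1) ^+ e b * spin_product i j e.
Proof.
move=> ij bj; rewrite /spin_product (bigD1 b) /=; last by lia.
congr (_ * _); apply: eq_bigl => k; rewrite -val_eqE /=; lia.
Qed.

Lemma spin_productSl i j (b : 'I_L) e : (i < j)%N -> b = i :> nat ->
  spin_product i j e = (-1) ^+ e b * spin_product i.+1 j e.
Proof.
move=> ij bj; rewrite /spin_product (bigD1 b) /=; last by lia.
congr (_ * _); apply: eq_bigl => k; rewrite -val_eqE /=; lia.
Qed.

Lemma sum_ordE (n : nat) (F : 'I_L -> R) (b : 'I_L) : b = n :> nat ->
  \sum_(k < L | k == n :> nat) F k = F b.
Proof.
by move=> bn; apply: big_pred1 => k; rewrite /= -bn val_eqE.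
Qed.

(** A jump over the bond (a, a+1) flips both sites, so the sign of the product changes only if the
    range [i, j) contains exactly one of them: a = j-1 or a = i-1. In these cases the jump removes,
    respectively adjoins, the factor of site [a]. *)
Lemma bulk_drift_spin i j e : (i < j)%N -> (j < L)%N ->
  \sum_z bulk_rate e z * (spin_product i j z - spin_product i j e) =
  (spin_product i j.-1 e - spin_product i j e) +
  (i != 0)%N%:R * (spin_product i.-1 j e - spin_product i j e).
Proof.
move=> ij jL; rewrite bulk_drift.
have bond (a : 'I_L) : \sum_(b < L | b == a.+1 :> nat)
    (e a)%:R * (spin_product i j (set_site (set_site e a false) b (~~ e b))
                - spin_product i j e) =
    (a == j.-1 :> nat)%:R * (spin_product i j.-1 e - spin_product i j e) +
    ((i != 0%N) && (a == i.-1 :> nat))%:R *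
      (spin_product i.-1 j e - spin_product i j e).
  (* The last site starts no bond; as j < L it is neither of the two exceptional sites. *)
  have [aL|La] := ltnP a.+1 L; last first.
    rewrite big_pred0; last by move=> b; have := ltn_ord b; lia.
    have -> : (a == j.-1 :> nat) = false by lia.
    have -> : (a == i.-1 :> nat) = false by lia.
    by rewrite andbF !mul0r addr0.
  pose b : 'I_L := Ordinal aL.
  have ba : b = a.+1 :> nat by [].
  clearbody b; rewrite (sum_ordE a.+1 _ b) // !spin_product_set.
  have -> : set_site e a false b = e b.
    by rewrite ffunE -val_eqE /= ba; case: eqP => //; lia.
  have -> : ~~ e b (+) e b by case: (e b).
  rewrite addFb andbT mulrA -signr_addb.
  have [aj|aj] := eqVneq (a : nat) j.-1.
    have jE : j = j.-1.+1 by lia.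
    have -> : (i <= b < j)%N = false by lia.
    have -> : (i <= a < j)%N by lia.
    have -> : (i != 0%N) && (a == i.-1 :> nat) = false by lia.
    rewrite [in spin_product i j e]jE (spin_productSr i j.-1 a) //; last by lia.
    by case: (e a) => /=; ring.
  have [/andP[i0 /eqP ai]|ai] := boolP ((i != 0%N) && (a == i.-1 :> nat)).
    have -> : (i <= b < j)%N by lia.
    have -> : (i <= a < j)%N = false by lia.
    rewrite (spin_productSl i.-1 j a) //; last by lia.
    rewrite prednK ?lt0n//.
    by case: (e a) => /=; ring.
  have -> : (i <= b < j)%N = (i <= a < j)%N by lia.
  by case: (e a); case: (i <= a < j)%N => /=; ring.
under eq_bigr do rewrite bond.
rewrite big_split /= -!mulr_suml; congr (_ + _).
  have jL' : (j.-1 < L)%N by lia.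
  rewrite -[RHS]mul1r; congr (_ * _).
  rewrite (bigD1 (Ordinal jL')) //= eqxx big1 ?addr0 // => k.
  by rewrite -val_eqE /= => /negbTE ->.
congr (_ * _).
have iL' : (i.-1 < L)%N by lia.
rewrite (bigD1 (Ordinal iL')) //= eqxx andbT big1 ?addr0 // => k.
by rewrite -val_eqE /= => /negbTE ->; rewrite andbF.
Qed.

(** The first site flips at rate [alpha] whatever its state, and this negates the product exactly
    when the range starts at 0. *)
Lemma left_drift_spin alpha i j e : (i < j)%N -> (j < L)%N ->
  \sum_z left_rate alpha e z * (spin_product i j z - spin_product i j e) =
  - ((i == 0)%N%:R * (2 * alpha * spin_product i j e)).
Proof.
move=> ij jL; rewrite left_drift.
have L0 : (0 < L)%N by lia.
rewrite (sum_ordE 0 _ (Ordinal L0)) // spin_product_set /=.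
have -> : (i <= 0 < j)%N = (i == 0)%N by lia.
by case: (e _); case: (i == 0)%N => /=; ring.
Qed.

Lemma right_drift_spin beta i j e : (j < L)%N ->
  \sum_z right_rate beta e z * (spin_product i j z - spin_product i j e) = 0.
Proof.
move=> jL; rewrite right_drift big1 // => a aL; rewrite spin_product_set.
have -> : (i <= a < j)%N = false by lia.
by rewrite mul1r subrr !mulr0.
Qed.

(** * Stationary two-point correlations of the spins *)

Definition correlation alpha beta (i j : nat) : R :=
  Defs.expectation (@rate R L alpha beta) (spin_product i j).

(** Two relations in one: for i > 0 this is the averaging rule 2 g(i, j) = g(i-1, j) + g(i, j-1),
    and for i = 0 it is the boundary rule g(0, j-1) = (1 + 2 alpha) g(0, j). *)
Lemma correlation_rec alpha beta i j : 0 < alpha -> 0 < beta ->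
  (i < j)%N -> (j < L)%N ->
  let g := correlation alpha beta in
  g i j.-1 - g i j + (i != 0)%N%:R * (g i.-1 j - g i j)
    - (i == 0)%N%:R * (2 * alpha * g i j) = 0.
Proof.
move=> a0 b0 ij jL /=.
rewrite -(stationary_drift0 _ _ _ (spin_product i j) (stationaryP L a0 b0)).
set p := stationary _; set f := spin_product.
have -> : \sum_e p e * \sum_z Defs.rate alpha beta e z * (f i j z - f i j e) =
    \sum_e (p e * f i j.-1 e - p e * f i j e
      + (i != 0)%N%:R * (p e * f i.-1 j e - p e * f i j e)
      - (i == 0)%N%:R * (2 * alpha * (p e * f i j e))).
  apply: eq_bigr => e _; rewrite /Defs.rate.
  under eq_bigr do rewrite !mulrDl.
  rewrite !big_split /= bulk_drift_spin // left_drift_spin //.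
  by rewrite right_drift_spin // addr0 /f; ring.
by rewrite !(sumrB, big_split, =^~ mulr_sumr).
Qed.

Lemma correlation_diag alpha beta i : 0 < alpha -> 0 < beta ->
  correlation alpha beta i i = 1.
Proof.
move=> a0 b0; have [_ <- _] := stationaryP L a0 b0.
by apply: eq_bigr => e _; rewrite spin_product_nil mulr1.
Qed.

(** Expand the product of two factors eta = (1 - (-1)^eta) / 2. *)
Lemma evaporation_rate_correlation alpha beta m : 0 < alpha -> 0 < beta ->
  (m.+2 <= L)%N ->
  let g := correlation alpha beta in
  evaporation_rate L alpha beta m.+2 =
  (1 - g m m.+1 - g m.+1 m.+2 + g m m.+2) / 4.
Proof.
move=> a0 b0 mL /=; have [_ s1 _] := stationaryP L a0 b0.
rewrite -{1}s1 /evaporation_rate /correlation /Defs.expectation -!sumrB -big_split /=.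
rewrite mulr_suml; apply: eq_bigr => e _.
have m1L : (m.+1 < L)%N by lia.
have m0L : (m < L)%N by lia.
pose a := Ordinal m0L; pose b := Ordinal m1L.
(* [occ] numbers the sites from 1, ordinals from 0. *)
have occE k (c : 'I_L) : c = k :> nat -> occ e k.+1 = e c.
  move=> <-; apply/existsP/idP => [[c' /andP[/eqP[]]]|ec].
    by move=> /val_inj ->.
  by exists c; rewrite eqxx.
rewrite (occE m a) // (occE m.+1 b) //.
rewrite (spin_productSr m m.+1 b) // (spin_productSr m m a) //.
rewrite (spin_productSr m.+1 m.+1 b) // !spin_product_nil.
by case: (e a); case: (e b) => /=; field.
Qed.

End Drift.

(** * Wallis' inequalities and the central binomial coefficient *)

Section Wallis.
Context {R : realType}.

(** The probability that a simple symmetric walk is back at its start after 2n steps. *)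
Definition central_ratio (n : nat) : R := 'C(n.*2, n)%:R / 4 ^+ n.

Lemma central_ratio_gt0 n : 0 < central_ratio n.
Proof. by rewrite divr_gt0 ?exprn_gt0 // ltr0n bin_gt0; lia. Qed.

Lemma central_ratioS n :
  n.+1.*2%:R * central_ratio n.+1 = n.*2.+1%:R * central_ratio n.
Proof.
have h : (n.+1 * 'C(n.+1.*2, n.+1) = 2 * n.*2.+1 * 'C(n.*2, n))%N.
  have := mul_bin_diag n.+1.*2 n; have := mul_bin_down n.*2.+1 n.
  have -> : (n.*2.+1 - n = n.+1)%N by lia.
  rewrite doubleS /=; nia.
rewrite /central_ratio exprS.
have : n.+1%:R * 'C(n.+1.*2, n.+1)%:R = 2 * n.*2.+1%:R * 'C(n.*2, n)%:R :> R.
  by rewrite -!natrM h.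
rewrite -muln2 natrM => h'.
have e4 : (4 : R) ^+ n != 0 by rewrite expf_neq0.
rewrite !mulrA [_ * 2 * _]mulrAC h'; by field.
Qed.

(* The reduction formula for the primitives of cos^n vanishing at 0, so that no
   integration is needed. *)
Fixpoint cos_primitive (n : nat) : R -> R :=
  match n with
  | 0 => id
  | 1 => sin
  | (k.+1 as k').+1 => fun t =>
      (k'%:R * cos_primitive k t + cos t ^+ k' * sin t) / k'.+1%:R
  end.

Lemma cos_primitive0 n : cos_primitive n 0 = 0.
Proof.
(* The recursion goes back two indices, so the induction carries two consecutive ones. *)
suff [] : cos_primitive n 0 = 0 /\ cos_primitive n.+1 0 = 0 by [].
elim: n => [|n [IH0 IH1]]; first by rewrite /= sin0.
by split => //=; rewrite IH0 sin0 !mulr0 addr0 mul0r.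
Qed.

Lemma is_derive_cos_primitive n (t : R) :
  is_derive t 1 (cos_primitive n) (cos t ^+ n).
Proof.
suff [] : is_derive t 1 (cos_primitive n) (cos t ^+ n) /\
          is_derive t 1 (cos_primitive n.+1) (cos t ^+ n.+1) by [].
elim: n => [|n [IH0 IH1]].
  by split => /=; [rewrite expr0; exact: is_derive_id | rewrite expr1; exact: is_derive_sin].
split => //.
have -> : cos_primitive n.+2 = n.+2%:R^-1 *:
    (n.+1%:R *: cos_primitive n + cos ^+ n.+1 * sin).
  by apply/funext => u /=; rewrite !fctE /= mulrC.
apply: is_derive_eq.
rewrite !fctE /GRing.scale /=.
have s : sin t ^+ 2 = 1 - cos t ^+ 2 by rewrite -(cos2Dsin2 t); ring.
have -> : sin t * (n.+1%:R * cos t ^+ n * - sin t) =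
          - (n.+1%:R * cos t ^+ n * sin t ^+ 2) by ring.
rewrite s -!natr1 !exprS.
have : n%:R + 1 + 1 != 0 :> R by rewrite !natr1 pnatr_eq0.
by move=> ?; field.
Qed.

Lemma cos_primitive_pihalfSS n :
  n.+2%:R * cos_primitive n.+2 (pi / 2) = n.+1%:R * cos_primitive n (pi / 2).
Proof. by rewrite /= cos_pihalf expr0n mul0r addr0 mulrC divfK ?pnatr_eq0. Qed.

(** The difference of the two primitives has derivative cos^n (1 - cos), which is nonnegative on
    [0, pi/2]; the mean value theorem concludes. *)
Lemma cos_primitive_pihalf_decr n :
  cos_primitive n.+1 (pi / 2) <= cos_primitive n (pi / 2) :> R.
Proof.
have pi2 : 0 <= pi / 2 :> R by rewrite divr_ge0 ?pi_ge0.
pose f : R -> R := cos_primitive n - cos_primitive n.+1.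
have df (t : R) : is_derive t 1 f (cos t ^+ n - cos t ^+ n.+1).
  have := is_derive_cos_primitive n t; have := is_derive_cos_primitive n.+1 t.
  by move=> ? ?; exact: is_deriveB.
have [|c c_in] := MVT_segment pi2 (fun t _ => df t).
  apply: continuous_subspaceT => t.
  exact/differentiable_continuous/derivable1_diffP.
rewrite /f !fctE !cos_primitive0 !subr0 => fE.
rewrite -subr_ge0 fE mulr_ge0 // exprS -{1}[cos c ^+ n]mul1r -mulrBl.
rewrite mulr_ge0 ?subr_ge0 ?cos_le1 // exprn_ge0 // cos_ge0_pihalf //.
by move: c_in; rewrite !in_itv /= => /andP[c0 ->]; rewrite (le_trans _ c0) // oppr_le0.
Qed.

Lemma cos_primitive_even n :
  cos_primitive n.*2 (pi / 2) = pi / 2 * central_ratio n :> R.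
Proof.
elim: n => [|n IH]; first by rewrite /= /central_ratio bin0 expr0 divr1 mulr1.
apply: (@mulfI R n.+1.*2%:R); first by rewrite pnatr_eq0 double_eq0.
by rewrite cos_primitive_pihalfSS IH mulrCA -central_ratioS mulrCA.
Qed.

Lemma cos_primitive_odd n :
  n.*2.+1%:R * central_ratio n * cos_primitive n.*2.+1 (pi / 2) = 1 :> R.
Proof.
elim: n => [|n IH].
  by rewrite /= sin_pihalf /central_ratio bin0 expr0 divr1 !mulr1.
rewrite mulrAC cos_primitive_pihalfSS mulrAC.
by rewrite -doubleS central_ratioS IH.
Qed.

(** Compare the Wallis integrals of indices 2n+1 and 2n, scaled so that the odd one becomes 1. *)
Lemma wallis_lower n : 2 <= pi * n.*2.+1%:R * central_ratio n ^+ 2 :> R.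
Proof.
have := cos_primitive_pihalf_decr n.*2.
rewrite cos_primitive_even -(ler_pM2l (_ : 0 < n.*2.+1%:R * central_ratio n)).
  by rewrite cos_primitive_odd; lra.
by rewrite mulr_gt0 ?central_ratio_gt0 ?ltr0n.
Qed.

(** Same scaling, with indices 2n+2 and 2n+1; [central_ratioS] then brings the ratio at n+1 back to
    n. *)
Lemma wallis_upper n :
  pi * n.*2.+1%:R ^+ 2 * central_ratio n ^+ 2 <= 2 * n.*2.+2%:R :> R.
Proof.
have := cos_primitive_pihalf_decr n.*2.+1.
rewrite -doubleS cos_primitive_even.
have a0 : 0 < n.*2.+1%:R * central_ratio n.
  by rewrite mulr_gt0 ?central_ratio_gt0 ?ltr0n.
rewrite -(ler_pM2l a0) cos_primitive_odd.
rewrite -(ler_pM2l (_ : 0 < 2 * n.*2.+2%:R)); last by rewrite mulr_gt0 ?ltr0n.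
have := central_ratioS n; rewrite -doubleS.
set c := central_ratio n; set c' := central_ratio n.+1.
set u := n.*2.+1%:R; set v := n.+1.*2%:R => h.
have -> : 2 * v * (u * c * (pi / 2 * c')) = u * c * pi * (v * c') by field.
rewrite h mulr1; apply: le_trans; rewrite le_eqVlt; apply/orP; left.
by apply/eqP; ring.
Qed.

Lemma cvg1_of_inv_bound (u : nat -> R) K :
  (forall n, (0 < n)%N -> `|u n - 1| <= K / n%:R) -> u @ \oo --> (1 : R).
Proof.
move=> uK; rewrite -(cvg_shiftS u).
have K0 : (fun n => K * harmonic n) @ \oo --> (0 : R).
  by rewrite -[X in _ --> X](mulr0 K); exact: (cvgM (cvg_cst K) cvg_harmonic).
apply/cvgrPdist_le => e e0.
have /cvgrPdist_le/(_ e e0) := K0; apply: filterS => n.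
rewrite sub0r normrN distrC; apply: le_trans.
by apply: le_trans (uK _ _) _ => //; rewrite ler_norm.
Qed.

(** With m = n+2, the factor left in the quotient of the rate by 1 / (8 sqrt(pi m^3)) once the
    normalized [reflected_sum] is split off. *)
Definition stirling_factor n : R :=
  Num.sqrt (pi * n.+2%:R ^+ 3) * central_ratio n / n.+1%:R.

(** Wallis' inequalities bound the square by rational functions of n. The constant 20 is generous:
    it makes the final polynomial difference have nonnegative coefficients. *)
Lemma stirling_factor_bounds n : (0 < n)%N ->
  1 <= stirling_factor n <= 1 + 20 / n%:R.
Proof.
move=> n0; have nR : 0 < n%:R :> R by rewrite ltr0n.
set s := stirling_factor n; set x : R := n%:R in nR *.
have s0 : 0 <= s.
  by rewrite divr_ge0 // mulr_ge0 ?sqrtr_ge0 // ltW // central_ratio_gt0.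
have n1 : n.+1%:R = x + 1 by rewrite natr1.
have n2 : n.+2%:R = x + 2 by rewrite -addn2 natrD.
have d1 : n.*2.+1%:R = 2 * x + 1 by rewrite -natr1 -muln2 natrM mulrC.
have d2 : n.*2.+2%:R = 2 * x + 2 by rewrite -doubleS -muln2 natrM n1; ring.
have x1 : 0 < (x + 1) ^+ 2 by rewrite exprn_gt0 //; lra.
have y1 : 0 < 2 * x + 1 by lra.
have z1 : 0 < (x + 2) ^+ 3 by rewrite exprn_gt0 //; lra.
have sE : s ^+ 2 * (x + 1) ^+ 2 = pi * central_ratio n ^+ 2 * (x + 2) ^+ 3.
  rewrite /s /stirling_factor n1 n2 -exprMn divfK; last by rewrite gt_eqF //; lra.
  rewrite exprMn sqr_sqrtr; last by rewrite mulr_ge0 ?pi_ge0 ?(ltW z1).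
  by ring.
have s1 : 1 <= s.
  rewrite -(@ler_pXn2r _ 2) ?nnegrE // expr1n.
  rewrite -(ler_pM2r x1) mul1r sE -(ler_pM2l y1).
  have w := wallis_lower n; rewrite d1 -(ler_pM2r z1) in w.
  have : (2 * x + 1) * (x + 1) ^+ 2 <= 2 * (x + 2) ^+ 3.
    rewrite -subr_ge0.
    have -> : 2 * (x + 2) ^+ 3 - (2 * x + 1) * (x + 1) ^+ 2 =
              7 * x ^+ 2 + 20 * x + 15 by ring.
    by rewrite !addr_ge0 ?mulr_ge0 ?exprn_ge0 ?(ltW nR).
  by lra.
(* Since s >= 1, bounding s^2 is enough and avoids the square root. *)
rewrite s1 /=; apply: (@le_trans _ _ (s ^+ 2)); first by rewrite expr2 ler_peMl.
rewrite -(ler_pM2r x1) sE -(ler_pM2l (exprn_gt0 2 y1)) -(ler_pM2r nR).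
have w := wallis_upper n; rewrite d1 d2 -(ler_pM2r z1) -(ler_pM2r nR) in w.
have -> : (2 * x + 1) ^+ 2 * ((1 + 20 / x) * (x + 1) ^+ 2) * x =
          (2 * x + 1) ^+ 2 * (x + 1) ^+ 2 * (x + 20) by field; rewrite gt_eqF.
have : 2 * (2 * x + 2) * (x + 2) ^+ 3 * x <=
       (2 * x + 1) ^+ 2 * (x + 1) ^+ 2 * (x + 20).
  rewrite -subr_ge0.
  have -> : (2 * x + 1) ^+ 2 * (x + 1) ^+ 2 * (x + 20) -
      2 * (2 * x + 2) * (x + 2) ^+ 3 * x =
      (x + 1) * (64 * x ^+ 3 + 117 * x ^+ 2 + 69 * x + 20) by ring.
  by rewrite !(mulr_ge0, addr_ge0, exprn_ge0) ?(ltW nR).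
by lra.
Qed.

End Wallis.

(** * Solution of the discrete boundary problem by reflection *)

Section Reflection.
Context {R : realFieldType}.
Implicit Types (x : R) (i j k : nat).

(* Reflection principle: up to the factor [2 ^ (k - i - j)], the net probability
   that the walk from (i + 1, j + 1), stepping left or down, first meets the
   axes at (0, k + 2), its mirror image (k + 2, 0) counting negatively. *)
Definition ballot i j k : R :=
  'C(i + j - k - 1, i)%:R - 'C(i + j - k - 1, j)%:R.

(** Each exit point (0, k+2) of the walk carries the boundary value (1-x)^2 x^k, the second
    difference of x^k; the powers of 2 are the path probabilities. *)
Definition reflected_sum x i j : R :=
  (1 - x) ^+ 2 / 2 ^+ (i + j) * \sum_(k < j) ballot i j k * (2 * x) ^+ k.

Lemma reflected_sum_diag x i : reflected_sum x i i = 0.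
Proof.
by rewrite /reflected_sum big1 ?mulr0 // => k _; rewrite /ballot subrr mul0r.
Qed.

Lemma reflected_sum0S x j :
  2 * reflected_sum x 0 j.+1 = (1 - x) ^+ 2 * x ^+ j + reflected_sum x 0 j.
Proof.
have b1 n k : (k < n)%N -> ballot 0 n k = 1.
  by move=> kn; rewrite /ballot bin0 bin_small ?subr0 //; lia.
rewrite /reflected_sum big_ord_recr /= b1 // mul1r !add0n.
rewrite (eq_bigr (fun k : 'I_j => (2 * x) ^+ k)); last first.
  by move=> k _; rewrite b1 ?mul1r // ltnS ltnW.
rewrite [in RHS](eq_bigr (fun k : 'I_j => (2 * x) ^+ k)); last first.
  by move=> k _; rewrite b1 ?mul1r.
have e2 : (2 : R) ^+ j != 0 by rewrite expf_neq0.
by rewrite (exprS _ j) exprMn; field.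
Qed.

Lemma ballotSS i j k : (k < j)%N ->
  ballot i.+1 j.+1 k = ballot i j.+1 k + ballot i.+1 j k.
Proof.
move=> kj; rewrite /ballot.
have -> : (i.+1 + j.+1 - k - 1 = (i + j - k).+1)%N by lia.
have -> : (i + j.+1 - k - 1 = i + j - k)%N by lia.
have -> : (i.+1 + j - k - 1 = i + j - k)%N by lia.
by rewrite !binS !natrD; ring.
Qed.

Lemma reflected_sumSS x i j : (i < j)%N ->
  2 * reflected_sum x i.+1 j.+1 =
  reflected_sum x i j.+1 + reflected_sum x i.+1 j.
Proof.
move=> ij; rewrite /reflected_sum !addnS !addSn !big_ord_recr /=.
(* The index k = j occurs only in the sums for j+1, where its coefficient is 1 on both sides. *)
have last1 n : (n <= j)%N -> ballot n j.+1 j = 1.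
  move=> nj; rewrite /ballot.
  have -> : (n + j.+1 - j - 1 = n)%N by lia.
  by rewrite binn bin_small ?subr0.
rewrite !last1 ?mul1r //; last exact: ltnW.
under eq_bigr => k _ do rewrite ballotSS // mulrDl.
rewrite big_split /=.
have e2 : (2 : R) ^+ (i + j) != 0 by rewrite expf_neq0.
by rewrite !(exprS 2); field.
Qed.

Lemma ballotE n k : (k <= n)%N ->
  ballot n n.+1 k = k.+1%:R / n.+1%:R * 'C(n.*2 - k, n)%:R.
Proof.
move=> kn; rewrite /ballot.
have -> : (n + n.+1 - k - 1 = n.*2 - k)%N by lia.
have := mul_bin_left (n.*2 - k) n; move/(congr1 (fun a => a%:R : R)).
have -> : (n.*2 - k - n = n - k)%N by lia.
rewrite !natrM natrB // -!natr1 => h.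
have n0 : n%:R + 1 != 0 :> R by rewrite natr1 pnatr_eq0.
apply: (mulfI n0); by rewrite mulrBr h; field.
Qed.

(** Both sides obey the same recursion with the same boundary data, so they agree by induction on i,
    then j. The cutoff [M] is there because correlations satisfy the recursion only inside the
    chain. *)
Lemma second_difference_reflected x (G : nat -> nat -> R) M :
  (forall i, G i i = 1) ->
  (forall j, (j < M)%N -> G 0 j = x ^+ j) ->
  (forall i j, (i < j)%N -> (j.+1 < M)%N ->
     2 * G i.+1 j.+1 = G i j.+1 + G i.+1 j) ->
  forall i j, (i < j)%N -> (j.+1 < M)%N ->
    G i j.+1 + G i.+1 j - G i j - G i.+1 j.+1 = reflected_sum x i j.
Proof.
move=> G1 G0 GS; elim => [|i IHi]; elim=> [//|j IHj] ij jM.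
  have := reflected_sum0S x j; have := GS 0 j.+1 isT jM.
  case: j => [|j] in IHj ij jM *.
    rewrite reflected_sum_diag (G0 2) // (G0 1) ?(G1 1) ?expr0; last by lia.
    by rewrite expr2 expr1; lra.
  have jM' : (j.+2 < M)%N by lia.
  rewrite -(IHj isT jM'); have := GS 0 j.+1 isT jM'.
  by rewrite !G0; [rewrite !exprS; lra|lia..].
have {}ij : (i < j)%N by [].
have jM' : (j.+1 < M)%N by lia.
have := reflected_sumSS x i j ij; rewrite -IHi //; last by lia.
have := GS i j.+1 (ltnW ij) jM; have := GS i j ij jM'.
have := GS i.+1 j.+1 ij jM.
case: (ltngtP i.+1 j) => [ij'|ij'|ij'].
- by rewrite -IHj //; have := GS i.+1 j ij' jM'; lra.
- by lia.
(* Next to the diagonal the recursion for [G] is missing at one neighbour; the vanishing of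
   [reflected_sum] and [G i i = 1] replace it. *)
- by subst j; rewrite reflected_sum_diag !G1; lra.
Qed.

(** * Asymptotics of the reflected sum *)

(** Passing from k to k+1 multiplies C(2n-k, n) 2^k by 2(n-k)/(2n-k), which lies between 1 - k/n and
    1; the losses add up to at most k^2/n. *)
Lemma ballot_term_bounds n k : (k <= n)%N ->
  ('C(n.*2 - k, n) * 2 ^ k <= 'C(n.*2, n))%N /\
  (n * 'C(n.*2, n) <=
   n * ('C(n.*2 - k, n) * 2 ^ k) + k ^ 2 * 'C(n.*2, n))%N.
Proof.
elim: k => [|k IH] kn; first by rewrite subn0 expn0 muln1; lia.
have [IH1 IH2] := IH (ltnW kn).
have := mul_bin_down (n.*2 - k) n.
have -> : (n.*2 - k - n = n - k)%N by lia.
have -> : ((n.*2 - k).-1 = n.*2 - k.+1)%N by lia.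
rewrite expnS => h.
set b := ('C(n.*2 - k, n) * 2 ^ k)%N in IH1 IH2.
set b' := ('C(n.*2 - k.+1, n) * _)%N.
have h' : ((n.*2 - k) * b' = (n - k).*2 * b)%N.
  by rewrite /b' /b mulnA h -[(n - k).*2]muln2 -!mulnA (mulnCA 2%N).
have N0 : (0 < n.*2 - k)%N by lia.
have bb : (b' <= b)%N.
  by rewrite -(leq_pmul2l N0) h' leq_mul2r; apply/orP; right; lia.
have nb : (n * b <= n * b' + k * b)%N.
  rewrite -(leq_pmul2l N0) mulnDr.
  have -> : ((n.*2 - k) * (n * b') = n * ((n - k).*2 * b))%N by rewrite -h' mulnCA.
  have -> : ((n - k).*2 = (n.*2 - k) - k)%N by lia.
  have nN : (n <= n.*2 - k)%N by lia.
  have kN : (k <= n.*2 - k)%N by lia.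
  move: (n.*2 - k)%N nN kN => N nN kN; rewrite mulnBl mulnBr.
  have : (n * (k * b) <= N * (k * b))%N by rewrite leq_mul2r nN orbT.
  have : (n * (k * b) <= n * (N * b))%N.
    by rewrite leq_mul2l leq_mul2r kN !orbT.
  by nia.
have kb : (k * b <= k * 'C(n.*2, n))%N by rewrite leq_mul2l IH1 orbT.
by split; nia.
Qed.

(** These are partial sums of the series of (1-x)^-(d+1). By Pascal's rule a factor 1-x lowers d by
    one, up to a boundary term of favourable sign. *)
Lemma binomial_series_le x d n : 0 <= x < 1 ->
  (1 - x) ^+ d.+1 * (\sum_(k < n) 'C(k + d, d)%:R * x ^+ k) <= 1.
Proof.
move=> /andP[x0 x1]; elim: d => [|d IH].
  rewrite (eq_bigr (fun k : 'I_n => x ^+ k)); last first.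
    by move=> k _; rewrite bin0 mul1r.
  by rewrite expr1 -opprB mulNr -subrX1 opprB gerBl exprn_ge0.
apply: le_trans IH; rewrite exprSr -mulrA ler_wpM2l ?exprn_ge0 ?subr_ge0 ?(ltW x1) //.
suff -> : (1 - x) * (\sum_(k < n) 'C(k + d.+1, d.+1)%:R * x ^+ k) =
  \sum_(k < n) 'C(k + d, d)%:R * x ^+ k - 'C(n + d, d.+1)%:R * x ^+ n.
  by rewrite gerBl mulr_ge0 ?exprn_ge0.
elim: n => [|n IHn].
  by rewrite !big_ord0 mulr0 bin_small ?mul0r ?subr0.
by rewrite !big_ord_recr /= mulrDr IHn addnS addSn binS natrD exprS; ring.
Qed.

Lemma geometric_derivative_sum x n :
  (1 - x) ^+ 2 * (\sum_(k < n) k.+1%:R * x ^+ k) =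
  1 - n.+1%:R * x ^+ n + n%:R * x ^+ n.+1.
Proof.
elim: n => [|n IH]; first by rewrite big_ord0 expr0; ring.
by rewrite big_ord_recr /= mulrDr IH -!natr1 !(exprS x); ring.
Qed.

(** Use (k+1) k^2 <= 6 C(k+3, 3) and the binomial series with d = 3. *)
Lemma cubic_power_sum_le x n : 0 <= x < 1 ->
  (1 - x) ^+ 4 * (\sum_(k < n) k.+1%:R * k%:R ^+ 2 * x ^+ k) <= 6.
Proof.
move=> x01; have := binomial_series_le x 3 n x01.
rewrite -(ler_pM2l (_ : 0 < 6)) // mulr1 mulrCA mulr_sumr; apply: le_trans.
case/andP: x01 => x0 x1.
rewrite ler_wpM2l ?exprn_ge0 ?subr_ge0 ?(ltW x1) //; apply: ler_sum => k _.
rewrite [leRHS]mulrA ler_wpM2r ?exprn_ge0 // -natrX -!natrM ler_nat.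
have -> : (6 * 'C(k + 3, 3) = (k + 3) * (k + 2) * (k + 1))%N.
  have := bin_ffact (k + 3) 3.
  by rewrite !ffactnS ffactn0 -[3`!]/6%N; nia.
by nia.
Qed.

(** After normalization, t = (1-x)^2 sum (k+1) x^k b_k with 1 - k^2/n <= b_k <= 1. Of the constant
    12, one half pays for b_k < 1 and the other for truncating the series. *)
Lemma reflected_sum_asymptotic x n : 0 <= x < 1 -> (0 < n)%N ->
  let t := reflected_sum x n n.+1 * 2 ^+ n.*2.+1 * n.+1%:R / 'C(n.*2, n)%:R in
  1 - 12 / (1 - x) ^+ 4 / n%:R <= t <= 1.
Proof.
move=> x01 n0; set t := (X in let _ := X in _) => /=; have /andP[x0 x1] := x01.
have B0 : 0 < 'C(n.*2, n)%:R :> R by rewrite ltr0n bin_gt0; lia.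
have nR : 0 < n%:R :> R by rewrite ltr0n.
have y0 : 0 < 1 - x by rewrite subr_gt0.
pose b k : R := 'C(n.*2 - k, n)%:R * 2 ^+ k / 'C(n.*2, n)%:R.
have b_le k : (k <= n)%N -> b k <= 1.
  move=> /ballot_term_bounds[le _].
  by rewrite /b ler_pdivrMr // mul1r -natrX -natrM ler_nat.
have b_ge k : (k <= n)%N -> 1 - k%:R ^+ 2 / n%:R <= b k.
  move=> /ballot_term_bounds[_]; rewrite -(ler_nat R) natrD !natrM !natrX => le.
  rewrite /b -(ler_pM2l nR) -(ler_pM2r B0).
  rewrite mulrBr mulrBl mulr1 mulrCA divff ?gt_eqF // mulr1 -!mulrA mulVf ?gt_eqF //.
  by lra.
have tE : t = (1 - x) ^+ 2 * \sum_(k < n.+1) k.+1%:R * x ^+ k * b k.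
  rewrite /t /reflected_sum (eq_bigr (fun k : 'I_n.+1 =>
    'C(n.*2, n)%:R / n.+1%:R * (k.+1%:R * x ^+ k * b k))); last first.
    move=> k _; have kn : (k <= n)%N by rewrite -ltnS.
    rewrite ballotE // /b exprMn.
    have n1 : 1 + n%:R != 0 :> R by rewrite addrC natr1 pnatr_eq0.
    by field; rewrite n1 gt_eqF.
  rewrite -mulr_sumr addnS addnn.
  have n1 : 1 + n%:R != 0 :> R by rewrite addrC natr1 pnatr_eq0.
  have e2 : (2 : R) ^+ n.*2.+1 != 0 by rewrite expf_neq0.
  by field; rewrite n1 e2 gt_eqF.
have y2 : 0 <= (1 - x) ^+ 2 by rewrite exprn_ge0 // ltW.
apply/andP; split; last first.
  have := binomial_series_le x 1 n.+1 x01; apply: le_trans.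
  rewrite tE ler_wpM2l //; apply: ler_sum => k _.
  rewrite addn1 bin1 ler_piMr //; first by rewrite mulr_ge0 // exprn_ge0.
  by rewrite b_le // -ltnS.
have t_ge : (1 - x) ^+ 2 * (\sum_(k < n.+1) k.+1%:R * x ^+ k) -
    (1 - x) ^+ 2 * (\sum_(k < n.+1) k.+1%:R * k%:R ^+ 2 * x ^+ k) / n%:R <= t.
  rewrite tE -mulrA -mulrBr ler_wpM2l // mulr_suml -sumrB.
  apply: ler_sum => k _.
  have := b_ge k; rewrite -ltnS => /(_ (ltn_ord k)) bk.
  have := ler_wpM2l (_ : 0 <= k.+1%:R * x ^+ k) bk.
  rewrite mulr_ge0 ?exprn_ge0 // => /(_ isT); apply: le_trans.
  by rewrite le_eqVlt; apply/orP; left; apply/eqP; ring.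
apply: le_trans t_ge; rewrite geometric_derivative_sum.
set S := \sum_(k < _) _.
have S0 m : 0 <= \sum_(k < m) k.+1%:R * k%:R ^+ 2 * x ^+ k.
  by apply: sumr_ge0 => k _; rewrite !mulr_ge0 ?exprn_ge0.
have c1 : (1 - x) ^+ 2 * S / n%:R <= 6 / (1 - x) ^+ 4 / n%:R.
  rewrite ler_pM2r ?invr_gt0 // ler_pdivlMr ?exprn_gt0 // mulrC.
  apply: le_trans (cubic_power_sum_le x n.+1 x01); rewrite -/S.
  rewrite ler_wpM2l ?exprn_ge0 ?(ltW y0) // ler_piMl ?S0 //.
  by rewrite exprn_ile1 ?(ltW y0) // lerBlDr lerDl.
(* The truncation error is dominated by the single term k = n+1 of the cubic sum. *)
have c2 : n.+2%:R * x ^+ n.+1 <= 6 / (1 - x) ^+ 4 / n%:R.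
  rewrite ler_pdivlMr // ler_pdivlMr ?exprn_gt0 // mulrC.
  apply: le_trans (cubic_power_sum_le x n.+2 x01).
  rewrite ler_wpM2l ?exprn_ge0 ?(ltW y0) // big_ord_recr /= ler_wpDl ?S0 //.
  rewrite mulrAC ler_wpM2r ?exprn_ge0 // ler_wpM2l //.
  by rewrite -natrX ler_nat; nia.
have c3 : 0 <= n.+1%:R * x ^+ n.+2 by rewrite mulr_ge0 ?exprn_ge0.
have -> : 12 / (1 - x) ^+ 4 / n%:R =
    6 / (1 - x) ^+ 4 / n%:R + 6 / (1 - x) ^+ 4 / n%:R.
  by rewrite -!mulrDl; congr (_ / _ / _); ring.
by lra.
Qed.

End Reflection.

(** * Exact formula and asymptotics of the evaporation rate *)

Section Evaporation.
Context {R : realType} (alpha beta : R).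
Context (alpha_gt0 : 0 < alpha) (beta_gt0 : 0 < beta).

Let den_gt0 : 0 < 1 + 2 * alpha.
Proof. by rewrite addr_gt0 ?mulr_gt0. Qed.

Let den_neq0 : 1 + 2 * alpha != 0.
Proof. by rewrite gt_eqF ?den_gt0. Qed.

Lemma evaporation_rate_reflected L n : (n.+2 < L)%N ->
  evaporation_rate L alpha beta n.+2 =
  reflected_sum (1 + 2 * alpha)^-1 n n.+1 / 4.
Proof.
move=> nL; rewrite evaporation_rate_correlation //; last exact: ltnW.
pose g := @correlation R L alpha beta; rewrite -/g.
have g1 i : g i i = 1 by exact: correlation_diag.
(* The 1 in the rate is g(n+1, n+1), the fourth corner of the second difference at (n, n+1). *)
rewrite -(second_difference_reflected _ g L g1) //; first by rewrite g1; field.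
- elim=> [|j IH] jL; first by rewrite g1.
  have := correlation_rec L alpha beta 0 j.+1 alpha_gt0 beta_gt0 isT jL.
  rewrite /= -/g IH; last exact: ltnW.
  move=> h; apply: (mulfI den_neq0); rewrite exprS mulrA divff // mul1r.
  by lra.
- move=> i j ij jL.
  have := correlation_rec L alpha beta i.+1 j.+1 alpha_gt0 beta_gt0 ij jL.
  by rewrite /= -/g; lra.
Qed.

Lemma evaporation_rate_formula L m : (2 <= m)%N -> (m < L)%N ->
  evaporation_rate L alpha beta m =
    alpha ^+ 2 / (2 ^+ (2 * m - 3) * (1 + 2 * alpha) ^+ m) *
    \sum_(0 <= i < m.-1)
      (m - 1 - i)%:R / (m - 1)%:R * 'C(m - 2 + i, i)%:R *
      (1 + 2 * alpha) ^+ i * 2 ^+ (m - 2 - i).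
Proof.
case: m => [|[|n]] // _ nL; rewrite evaporation_rate_reflected //=.
(* With m = n+2 the summation indices correspond by i = n - k. Since 1 - x = 2 alpha / (1 + 2
   alpha), the square (1-x)^2 supplies alpha^2 and cancels the 4. *)
rewrite big_mkord (reindex_inj rev_ord_inj) /= /reflected_sum mulrAC !mulr_sumr.
apply: eq_bigr => k _; have kn : (k <= n)%N by rewrite -ltnS.
rewrite ballotE // (subSS k n).
have -> : (n.+2 - 1 - (n - k) = k.+1)%N by lia.
have -> : (n.+2 - 2 + (n - k) = n.*2 - k)%N by lia.
have -> : (n.+2 - 2 - (n - k) = k)%N by lia.
have -> : (2 * n.+2 - 3 = n + n.+1)%N by lia.
have -> : (n.+2 - 1 = n.+1)%N by lia.
have -> : 'C(n.*2 - k, n - k) = 'C(n.*2 - k, n).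
  by rewrite -bin_sub; [congr binomial|]; lia.
have a0 := den_neq0.
have -> : (1 + 2 * alpha) ^+ n.+2 =
    (1 + 2 * alpha) ^+ (n - k) * (1 + 2 * alpha) ^+ k * (1 + 2 * alpha) ^+ 2.
  by rewrite -!exprD; congr (_ ^+ _); lia.
rewrite exprMn exprVn.
have := expf_neq0 k a0; have := expf_neq0 (n - k) a0.
move: (_ ^+ k) (_ ^+ (n - k)) => u v u0 v0.
have e2 : (2 : R) ^+ (n + n.+1) != 0 by rewrite expf_neq0.
have n0 : n.+1%:R != 0 :> R by rewrite pnatr_eq0.
by field; do ?[apply/andP; split].
Qed.

Lemma evaporation_rate_asymptotic (L : nat -> nat) : (forall m, (m < L m)%N) ->
  (fun m : nat => evaporation_rate (L m) alpha beta m /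
                  (1 / (8 * Num.sqrt (pi * m%:R ^+ 3)))) @ \oo --> (1 : R).
Proof.
move=> mL; set r := (fun m : nat => _).
pose x := (1 + 2 * alpha)^-1.
have x01 : 0 <= x < 1.
  by rewrite invr_ge0 ltW ?den_gt0 // invf_lt1 ?den_gt0 // ltrDl mulr_gt0.
pose t n := reflected_sum x n n.+1 * 2 ^+ n.*2.+1 * n.+1%:R / 'C(n.*2, n)%:R.
have cvg_t : t @ \oo --> (1 : R).
  apply: (cvg1_of_inv_bound t (12 / (1 - x) ^+ 4)) => n n0.
  have /andP[lo hi] := reflected_sum_asymptotic x n x01 n0.
  by rewrite distrC ger0_norm ?subr_ge0 //; rewrite /t; lra.
have cvg_s : stirling_factor @ \oo --> (1 : R).
  apply: (cvg1_of_inv_bound _ 20) => n n0.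
  have /andP[lo hi] := @stirling_factor_bounds R n n0.
  by rewrite ger0_norm ?subr_ge0 //; lra.
have cvg_ts : (fun n => t n * stirling_factor n) @ \oo --> (1 : R).
  by have := cvgM cvg_t cvg_s; rewrite mulr1; exact.
(* At m = n+2 the quotient is exactly the product of two factors tending to 1. *)
rewrite -(cvg_shiftn 2); set v := [sequence _]_ _.
suff -> : v = (fun n => t n * stirling_factor n) by [].
apply/funext => n; rewrite /v /= addn2 /r evaporation_rate_reflected //.
rewrite -/x /t /stirling_factor /central_ratio.
have -> : (4 : R) ^+ n = 2 ^+ n.*2 by rewrite -mul2n exprM; congr (_ ^+ _); ring.
have B0 : 'C(n.*2, n)%:R != 0 :> R by rewrite pnatr_eq0 -lt0n bin_gt0; lia.
have n1 : n.+1%:R != 0 :> R by rewrite pnatr_eq0.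
have e2 : (2 : R) ^+ n.*2 != 0 by rewrite expf_neq0.
have q0 : Num.sqrt (pi * n.+2%:R ^+ 3) != 0 :> R.
  by rewrite gt_eqF // sqrtr_gt0 mulr_gt0 ?pi_gt0 ?exprn_gt0.
rewrite (exprS 2); move: n.+1%:R n1 => u n1.
by field; do ?[apply/andP; split].
Qed.

End Evaporation.

Theorem mainTheorem7 (R : realType) (alpha beta : R)
    (halpha : 0 < alpha) (hbeta : 0 < beta) :
  (forall L m : nat, (2 <= m)%N -> (m < L)%N ->
    evaporation_rate L alpha beta m =
      alpha ^+ 2 / (2 ^+ (2 * m - 3) * (1 + 2 * alpha) ^+ m) *
      \sum_(0 <= i < m.-1)
        (m - 1 - i)%:R / (m - 1)%:R * 'C(m - 2 + i, i)%:R *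
        (1 + 2 * alpha) ^+ i * 2 ^+ (m - 2 - i))
  /\
  (forall L : nat -> nat, (forall m, (m < L m)%N) ->
    (fun m : nat => evaporation_rate (L m) alpha beta m /
                    (1 / (8 * Num.sqrt (pi * m%:R ^+ 3)))) @ \oo --> (1 : R)).
Proof.
split; first by move=> L m; exact: evaporation_rate_formula.
by move=> L; exact: evaporation_rate_asymptotic.
Qed.
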